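(* Let $A\in\mathbb{R}^{m\times n}$ have full column rank (so $m\ge n$), let $b\in\mathbb{R}^m$, let $x=(A^tA)^{-1}A^tb$ be the solution of the linear least-squares problem $\min_u\|b-Au\|_2$, let $r=b-Ax$, and let $\sigma_{\min}$ be the smallest singular value of $A$. Let $\mathcal{A},\mathcal{B},\mathcal{X}>0$ be constant scale factors, and let $\chi_x(A)$ and $\chi_x(b)$ be the condition numbers of $x$ with respect to $A$ and with respect to $b$ for the scaled norms $\|\Delta A\|_2/\mathcal{A}$, $\|\Delta b\|_2/\mathcal{B}$, $\|\Delta x\|_2/\mathcal{X}$. Then $$\chi_x(b)=\frac{\mathcal{B}}{\mathcal{X}\,\sigma_{\min}},\qquad \chi_x(A)=\frac{\mathcal{A}}{\mathcal{X}}\max_{\|\Delta x\|_2=1}(\sigma_1+\sigma_2),$$ where the maximum is over $\Delta x\in\mathbb{R}^n$ and, for each $\Delta x$, $\sigma_1$ and $\sigma_2$ are the singular values of the $m\times n$ matrix $u_1v_1^t+u_2v_2^t$ of rank at most $2$ (its two largest singular values, with zeros supplied if there are fewer than two), with $$u_1=r=b-Ax,\qquad v_1=(A^tA)^{-1}\Delta x,\qquad u_2=-A(A^tA)^{-1}\Delta x,\qquad v_2=x.$$ Moreover, $$\frac{\mathcal{A}}{\mathcal{X}\sigma_{\min}}\sqrt{\left(\frac{\|r\|_2}{\sigma_{\min}}\right)^2+\|x\|_2^2}\;\le\;\chi_x(A)\;\le\;\frac{\mathcal{A}}{\mathcal{X}\sigma_{\min}}\left(\frac{\|r\|_2}{\sigma_{\min}}+\|x\|_2\right),$$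 and this upper bound exceeds $\chi_x(A)$ by at most a factor $\sqrt2$, i.e. the upper bound is at most $\sqrt2\,\chi_x(A)$. Finally, if $x\ne0$ and the scale factors are $\mathcal{A}=\|A\|_2$, $\mathcal{B}=\|b\|_2$, $\mathcal{X}=\|x\|_2$, then the formula for $\chi_x(b)$ and the limits for $\chi_x(A)$ simplify to $$\chi_x(b)=v\sec(\theta),\qquad \kappa_2\sqrt{[v\tan(\theta)]^2+1}\;\le\;\chi_x(A)\;\le\;\kappa_2\,[v\tan(\theta)+1],$$ where $$\kappa_2=\frac{\|A\|_2}{\sigma_{\min}},\qquad v=\frac{\|Ax\|_2}{\|x\|_2\,\sigma_{\min}},\qquad \tan(\theta)=\frac{\|r\|_2}{\|Ax\|_2},$$ and $\theta\in[0,\pi/2)$ is the angle between $b$ and the column space of $A$.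
   Context: For vectors $\|\cdot\|_2$ is the Euclidean norm; for matrices $\|\cdot\|_2$ is the spectral norm (largest singular value). The superscript $t$ denotes transpose. Condition numbers are the induced operator norms of the Fréchet derivatives (Jacobians) of the solution with respect to one datum with the other held fixed. On the open set of $m\times n$ matrices of full column rank, the solution map is $(A,b)\mapsto x=(A^tA)^{-1}A^tb$. With $D_Ax:\mathbb{R}^{m\times n}\to\mathbb{R}^n$ the derivative of $x$ with respect to $A$ at $(A,b)$ ($b$ fixed) and $D_bx:\mathbb{R}^m\to\mathbb{R}^n$ the derivative of $x$ with respect to $b$ at $(A,b)$ ($A$ fixed), $$\chi_x(A)=\max_{\Delta A\ne0}\frac{\|D_Ax[\Delta A]\|_2/\mathcal{X}}{\|\Delta A\|_2/\mathcal{A}},\qquad \chi_x(b)=\max_{\Delta b\ne0}\frac{\|D_bx[\Delta b]\|_2/\mathcal{X}}{\|\Delta b\|_2/\mathcal{B}}.$$ Here $\|\Delta A\|_2$ is the spectral norm of the matrix $\Delta A$. *)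

(* Defs.v *)
From HB Require Import structures.
From mathcomp Require Import all_boot all_order all_algebra.
From mathcomp Require Import polyrcf.
From mathcomp Require Import all_classical all_reals all_analysis.

Set Implicit Arguments.
Unset Strict Implicit.
Unset Printing Implicit Defensive.

Import Order.TTheory GRing.Theory Num.Theory.
Import numFieldNormedType.Exports.

Local Open Scope classical_set_scope.
Local Open Scope ring_scope.

Section Maximum.
Variable R : realType.

Definition has_max (S : set R) : Prop := exists2 M, S M & ubound S M.

(* This is [sup S], hence the maximum of S only when [has_max S] holds;
   attainment has to be claimed separately. *)
Definition max_of (S : set R) : R := sup S.

End Maximum.

Section EuclideanGeometry.
Variable R : realType.

Definition dotv (k : nat) (u v : 'cV[R]_k) : R := \sum_(i < k) u i 0 * v i 0.

(* The norm `|v| that MathComp-Analysis puts on matrices is the entrywise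
   maximum; it only serves as the topology for the Frechet derivatives. *)
Definition norm2 (k : nat) (v : 'cV[R]_k) : R := Num.sqrt (dotv v v).

Definition vangle (k : nat) (u v : 'cV[R]_k) : R :=
  acos (dotv u v / (norm2 u * norm2 v)).

(* Angle between b and the column space of A: the infimum of the angles
   between b and the nonzero vectors A u. *)
Definition angle_colspace (m n : nat) (A : 'M[R]_(m, n)) (b : 'cV[R]_m) : R :=
  inf [set vangle b (A *m u) | u in [set u : 'cV[R]_n | A *m u != 0]].

End EuclideanGeometry.

Section SingularValues.
Variable R : realType.

(* The real roots of p, each repeated according to its multiplicity. *)
Definition rootsR_mult (p : {poly R}) : seq R :=
  flatten [seq nseq (mup l p) l | l <- rootsR p].

(* The min(m, n) singular values of M in nonincreasing order: the square roots
   of the eigenvalues of M^T M, with multiplicity (when m < n the last n - m of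
   these are zero and are dropped). *)
Definition singvals (m n : nat) (M : 'M[R]_(m, n)) : seq R :=
  take (minn m n)
    (sort >=%R [seq Num.sqrt l | l <- rootsR_mult (char_poly (M^T *m M))]).

(* k counts from 0; missing singular values are read as 0. *)
Definition singval (m n : nat) (M : 'M[R]_(m, n)) (k : nat) : R :=
  nth 0 (singvals M) k.

Definition spnorm (m n : nat) (M : 'M[R]_(m, n)) : R := singval M 0.

Definition sigma_min (m n : nat) (M : 'M[R]_(m, n)) : R :=
  singval M (minn m n).-1.

End SingularValues.

Section LeastSquares.
Variables (R : realType) (m n : nat).
Implicit Types (A : 'M[R]_(m, n)) (b : 'cV[R]_m).

(* [invmx] is total, so this is defined for every A; it is the least-squares
   solution on the open set of matrices of full column rank. *)
Definition lsq A b : 'cV[R]_n := invmx (A^T *m A) *m A^T *m b.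

Definition condA_ratios (cA cX : R) A b : set R :=
  [set (norm2 ('d (fun A' => lsq A' b) A dA) / cX) / (spnorm dA / cA)
     | dA in [set dA : 'M[R]_(m, n) | dA != 0]].

Definition condb_ratios (cB cX : R) A b : set R :=
  [set (norm2 ('d (lsq A) b db) / cX) / (norm2 db / cB)
     | db in [set db : 'cV[R]_m | db != 0]].

Definition condA (cA cX : R) A b : R := max_of (condA_ratios cA cX A b).

Definition condb (cB cX : R) A b : R := max_of (condb_ratios cB cX A b).

Definition rank2_mx A b (dx : 'cV[R]_n) : 'M[R]_(m, n) :=
  let x := lsq A b in
  let u1 := b - A *m x in
  let v1 := invmx (A^T *m A) *m dx in
  let u2 := - (A *m invmx (A^T *m A) *m dx) in
  let v2 := x in
  u1 *m v1^T + u2 *m v2^T.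

Definition sigma12_values A b : set R :=
  [set singval (rank2_mx A b dx) 0 + singval (rank2_mx A b dx) 1
     | dx in [set dx : 'cV[R]_n | norm2 dx = 1]].

End LeastSquares.

(* Main.v *)
(* For a perturbation dA the derivative is
   D_A x [dA] = (A^T A)^-1 (dA^T r - A^T dA x), so that its inner product with
   dx is the trace of dA^T M(dx), where M(dx) = u1 v1^T + u2 v2^T. The spectral
   norm is dual to the sum of the singular values for the trace pairing, and
   M(dx) has rank at most 2; hence chi_x(A) is A/X times the maximum of
   sigma_1 + sigma_2 over the unit sphere, which exists by compactness.
   The upper bound is |u1| |v1| + |u2| |v2|. For the lower bound, u1 and u2 are
   orthogonal, so (sigma_1 + sigma_2)^2 >= tr (M^T M) = |u1|^2 |v1|^2 +
   |u2|^2 |v2|^2, evaluated at a singular vector of A for sigma_min. *)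

(* The Euclidean norm of the derivative is itself a maximum of inner products with unit vectors
   [dx], so two maxima, over [dA] and over [dx], are exchanged. Because the trace duality is
   attained, a single optimal contraction also stands in for the norm properties of the sum of
   singular values. Two obstacles shape the rest. Singular values are sorted square roots of
   polynomial roots, so an orthogonal diagonalisation of M^T M has to be matched with that list
   before anything can be estimated. And the solution contains a matrix inverse, whose derivative is
   avoided by comparing the normal equations at A and at A + h, which leaves a remainder of second
   order. The factor sqrt 2 is the largest ratio between p + q and sqrt (p^2 + q^2). *)
Require Import Defs.
From HB Require Import structures.
From mathcomp Require Import all_boot all_order all_algebra.
From mathcomp Require Import perm spectral polyrcf complex ring lra.
From mathcomp Require Import all_classical all_reals all_analysis.

Set Implicit Arguments.
Unset Strict Implicit.
Unset Printing Implicit Defensive.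

Import Order.TTheory GRing.Theory Num.Theory.
Import numFieldNormedType.Exports.

Local Open Scope classical_set_scope.
Local Open Scope ring_scope.

(** * Euclidean geometry and the real spectral theorem *)

Section Euclid.
Variable R : realType.
Implicit Types k m n : nat.

Lemma dotvE k (u v : 'cV[R]_k) : dotv u v = (u^T *m v) 0 0.
Proof. by rewrite mxE; apply: eq_bigr => i _; rewrite mxE. Qed.

Lemma dotvC k (u v : 'cV[R]_k) : dotv u v = dotv v u.
Proof. by apply: eq_bigr => i _; rewrite mulrC. Qed.

Lemma dotvDl k (u v w : 'cV[R]_k) : dotv (u + v) w = dotv u w + dotv v w.
Proof. by rewrite -big_split; apply: eq_bigr => i _; rewrite mxE mulrDl. Qed.

Lemma dotvZl k a (u w : 'cV[R]_k) : dotv (a *: u) w = a * dotv u w.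
Proof. by rewrite mulr_sumr; apply: eq_bigr => i _; rewrite mxE mulrA. Qed.

Lemma dotvDr k (u v w : 'cV[R]_k) : dotv w (u + v) = dotv w u + dotv w v.
Proof. by rewrite !(dotvC w) dotvDl. Qed.

Lemma dotvZr k a (u w : 'cV[R]_k) : dotv w (a *: u) = a * dotv w u.
Proof. by rewrite !(dotvC w) dotvZl. Qed.

Lemma dotvNl k (u w : 'cV[R]_k) : dotv (- u) w = - dotv u w.
Proof. by rewrite -scaleN1r dotvZl mulN1r. Qed.

Lemma dotvNr k (u w : 'cV[R]_k) : dotv w (- u) = - dotv w u.
Proof. by rewrite !(dotvC w) dotvNl. Qed.

Lemma dotv_mulmxl m n (M : 'M[R]_(m, n)) u v :
  dotv (M *m u) v = dotv u (M^T *m v).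
Proof. by rewrite !dotvE trmx_mul mulmxA. Qed.

Lemma dotv_mulmxr m n (M : 'M[R]_(m, n)) u v :
  dotv v (M *m u) = dotv (M^T *m v) u.
Proof. by rewrite dotvC dotv_mulmxl dotvC. Qed.

Lemma dotvv_ge0 k (u : 'cV[R]_k) : 0 <= dotv u u.
Proof. by apply: sumr_ge0 => i _; rewrite -expr2 sqr_ge0. Qed.

Lemma dotvv_eq0 k (u : 'cV[R]_k) : (dotv u u == 0) = (u == 0).
Proof.
apply/eqP/eqP => [u0|->]; last by rewrite dotvE mulmx0 mxE.
apply/matrixP => i j; rewrite ord1 mxE.
have /psumr_eq0P : forall i : 'I_k, true -> 0 <= u i 0 * u i 0.
  by move=> l _; rewrite -expr2 sqr_ge0.
by move=> /(_ u0 i isT)/eqP; rewrite mulf_eq0 orbb => /eqP.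
Qed.

Lemma norm2_ge0 k (u : 'cV[R]_k) : 0 <= norm2 u.
Proof. exact: sqrtr_ge0. Qed.

Lemma norm2_sqr k (u : 'cV[R]_k) : norm2 u ^+ 2 = dotv u u.
Proof. by rewrite sqr_sqrtr ?dotvv_ge0. Qed.

Lemma norm2_eq0 k (u : 'cV[R]_k) : (norm2 u == 0) = (u == 0).
Proof. by rewrite -dotvv_eq0 -norm2_sqr sqrf_eq0. Qed.

Lemma norm2_gt0 k (u : 'cV[R]_k) : (0 < norm2 u) = (u != 0).
Proof. by rewrite lt0r norm2_ge0 andbT norm2_eq0. Qed.

Lemma norm2_0 k : norm2 (0 : 'cV[R]_k) = 0.
Proof. by apply/eqP; rewrite norm2_eq0. Qed.

Lemma norm2Z k a (u : 'cV[R]_k) : norm2 (a *: u) = `|a| * norm2 u.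
Proof.
by rewrite /norm2 dotvZl dotvZr mulrA -expr2 sqrtrM ?sqr_ge0// sqrtr_sqr.
Qed.

Lemma norm2N k (u : 'cV[R]_k) : norm2 (- u) = norm2 u.
Proof. by rewrite -scaleN1r norm2Z normrN1 mul1r. Qed.

Lemma norm2_le k l (u : 'cV[R]_k) (v : 'cV[R]_l) :
  (norm2 u <= norm2 v) = (dotv u u <= dotv v v).
Proof. by rewrite ler_sqrt ?dotvv_ge0. Qed.

Lemma Cauchy_Schwarz k (u v : 'cV[R]_k) : `|dotv u v| <= norm2 u * norm2 v.
Proof.
rewrite -ler_sqr ?nnegrE ?mulr_ge0 ?norm2_ge0// real_normK ?num_real//.
rewrite exprMn !norm2_sqr.
have [->|v0] := eqVneq v 0.
  by rewrite !dotvE !mulmx0 !mxE expr0n mulr0.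
have vv0 : 0 < dotv v v by rewrite lt0r dotvv_ge0 dotvv_eq0 v0.
have := dotvv_ge0 (dotv v v *: u - dotv u v *: v).
rewrite !(dotvDl, dotvDr, dotvNl, dotvNr, dotvZl, dotvZr) (dotvC v u).
set a := dotv u u; set b := dotv u v; set c := dotv v v in vv0 *.
rewrite [leRHS](_ : _ = c * (a * c - b ^+ 2)); last by ring.
by rewrite pmulr_rge0// subr_ge0.
Qed.

Lemma dotv_le_norm2 k (u v : 'cV[R]_k) : dotv u v <= norm2 u * norm2 v.
Proof. exact: le_trans (ler_norm _) (Cauchy_Schwarz _ _). Qed.

Lemma norm2D k (u v : 'cV[R]_k) : norm2 (u + v) <= norm2 u + norm2 v.
Proof.
rewrite -ler_sqr ?nnegrE ?addr_ge0 ?norm2_ge0// norm2_sqr sqrrD !norm2_sqr.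
rewrite !(dotvDl, dotvDr) (dotvC v u); have := dotv_le_norm2 u v; lra.
Qed.

Lemma norm2_orthogonal n (Q : 'M[R]_n) u :
  Q^T *m Q = 1%:M -> norm2 (Q *m u) = norm2 u.
Proof. by move=> QQ; rewrite /norm2 dotv_mulmxl mulmxA QQ mul1mx. Qed.

Lemma norm2_row_orthogonal n (Q : 'M[R]_n) i :
  Q *m Q^T = 1%:M -> norm2 (row i Q)^T = 1.
Proof.
move=> /matrixP/(_ i i) QQ; rewrite /norm2 -[RHS]sqrtr1; congr Num.sqrt.
rewrite !mxE eqxx in QQ; rewrite -[RHS]QQ.
by apply: eq_bigr => j _; rewrite !mxE.
Qed.

End Euclid.

Section RealSpectral.
Variable R : realType.

(** Over the closed field [R[i]] an eigenvalue exists; it is real by the Hermitian argument and, as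
    a root of a characteristic polynomial over [R], it descends. *)
Lemma symmetric_eigenvalue n (G : 'M[R]_n) : (0 < n)%N -> G^T = G ->
  exists a, eigenvalue G a.
Proof.
move=> n_gt0 Gsym; pose f := real_complex R.
have [a a_eig] := @eigenvalue_closed R[i] n (map_mx f G) n_gt0.
suff [x ax] : exists x, a = f x.
  exists x; rewrite eigenvalue_root_char -(fmorph_root f) map_char_poly.
  by rewrite -eigenvalue_root_char [X in eigenvalue _ X](esym ax).
have /eigenvalueP[v va v0] := a_eig.
pose w := map_mx Num.conj v^T.
have GC : map_mx Num.conj (map_mx f G) = map_mx f G.
  apply/matrixP => i j; rewrite !mxE; apply: CrealP.
  by apply/complex_realP; exists (G i j).
(* Both sides are v G w, with [G] acting on [v] from the right or on its conjugate [w] from the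
   left. *)
have E : a *: (v *m w) = a^* *: (v *m w).
  rewrite scalemxAl -va -mulmxA scalemxAr; congr (_ *m _).
  have /(congr1 (fun X => map_mx Num.conj X^T)) := va.
  rewrite trmx_mul map_mxM map_trmx Gsym GC => ->.
  by rewrite linearZ/= map_mxZ.
have vw0 : (v *m w) 0 0 != 0.
  have [i vi] : exists i, v 0 i != 0.
    apply/existsP; apply: contraNT v0; rewrite negb_exists => /forallP v0.
    by apply/eqP/rowP => i; rewrite mxE; apply/eqP; rewrite -[_ == _]negbK v0.
  rewrite mxE psumr_neq0 => [|j _]; last by rewrite !mxE mul_conjC_ge0.
  apply/hasP; exists i; first by rewrite mem_index_enum.
  by rewrite !mxE /= mul_conjC_gt0.
have : a \is Num.real.
  apply/CrealP; apply: (mulIf vw0); symmetry.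
  by have /matrixP/(_ 0 0) := E; rewrite !mxE.
by move=> /complex_realP[x ->]; exists x.
Qed.

Lemma orthogonal_first_row n (v : 'rV[R]_n.+1) : (v *m v^T) 0 0 = 1 ->
  exists H : 'M[R]_n.+1, H *m H^T = 1%:M /\ row 0 H = v.
Proof.
move=> vv; pose e : 'rV[R]_n.+1 := delta_mx 0 0.
have ee : (e *m e^T) 0 0 = 1 by rewrite trmx_delta mul_delta_mx mxE eqxx.
have [->|ev] := eqVneq v e.
  by exists 1%:M; rewrite trmx1 mulmx1 rowE mulmx1.
pose w := e - v; pose c := (w *m w^T) 0 0.
have c0 : c != 0.
  have : dotv w^T w^T != 0 by rewrite dotvv_eq0 trmx_eq0 subr_eq0 eq_sym.
  by rewrite dotvE trmxK.
have scal (X : 'M[R]_1) : X = (X 0 0)%:M by rewrite [LHS]mx11_scalar.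
(* The Householder reflection exchanging e and v. *)
pose H := 1%:M - (2 / c) *: (w^T *m w).
have HT : H^T = H by rewrite linearB/= trmx1 linearZ/= trmx_mul trmxK.
exists H; split.
  rewrite HT mulmxBl mul1mx mulmxBr mulmx1 -scalemxAl -scalemxAr.
  rewrite [w^T *m w *m _]mulmxA -(mulmxA w^T w w^T) (scal (w *m w^T)) -/c.
  rewrite mul_mx_scalar -scalemxAl !scalerA.
  have -> : 2 / c * (2 / c) * c = 2 / c + 2 / c by field.
  rewrite scalerDl; set Z := _ *: _.
  by rewrite opprB addrK subrK.
rewrite rowE -/e mulmxBr mulmx1 -scalemxAr mulmxA (scal (e *m w^T)).
rewrite mul_scalar_mx scalerA.
(* As e and v are unit vectors, c = |e - v|^2 = 2 (1 - <e, v>) = 2 <e, w>. *)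
have -> : 2 / c * (e *m w^T) 0 0 = 1.
  have ev' : (v *m e^T) 0 0 = (e *m v^T) 0 0.
    by rewrite -[v *m e^T]trmxK trmx_mul trmxK mxE.
  rewrite mulrAC; apply: (mulIf c0); rewrite mul1r divfK//.
  have subE (X Y : 'M[R]_1) : (X - Y) 0 0 = X 0 0 - Y 0 0 by rewrite !mxE.
  rewrite /c /w linearB/= !mulmxBl !mulmxBr !subE ee vv ev'; ring.
by rewrite scale1r /w opprB addrC subrK.
Qed.

(** Deflation: in an orthonormal basis starting with an eigenvector the first row is a multiple of
    e_0, by symmetry so is the first column, and the remaining block is again symmetric. *)
Theorem symmetric_spectral n (G : 'M[R]_n) : G^T = G ->
  exists Q (d : 'rV[R]_n), Q *m Q^T = 1%:M /\ G = Q^T *m diag_mx d *m Q.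
Proof.
elim: n => [|n IHn] in G *.
  by exists 1%:M, 0; split; apply/matrixP; case.
move=> Gsym; have [a /eigenvalueP[v0 v0a v0N]] :=
  symmetric_eigenvalue (ltn0Sn n) Gsym.
pose v := (norm2 v0^T)^-1 *: v0.
have va : v *m G = a *: v by rewrite -scalemxAl v0a !scalerA mulrC.
have vv : (v *m v^T) 0 0 = 1.
  have n0 : norm2 v0^T != 0 by rewrite norm2_eq0 trmx_eq0.
  have -> : (v *m v^T) 0 0 = dotv v^T v^T by rewrite dotvE trmxK.
  rewrite linearZ/= dotvZl dotvZr -norm2_sqr; field.
  by [].
have [H [HH rH]] := orthogonal_first_row vv.
have HTH : H^T *m H = 1%:M by apply: mulmx1C.
(* The existential makes [K] opaque and gives it the size 1 + n that the block operations need. *)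
have [K KE] : exists K : 'M[R]_(1 + n), K = H *m G *m H^T by eexists.
have Ksym : K^T = K by rewrite KE !trmx_mul trmxK Gsym mulmxA.
have K0 : row 0 K = a *: delta_mx 0 0.
  rewrite KE !row_mul rH va -scalemxAl -rH rowE -mulmxA HH mulmx1//.
have Kur : ursubmx K = 0.
  apply/matrixP => i j; rewrite ord1.
  have /rowP/(_ (rshift 1 j)) := K0; rewrite !mxE/= mulr0 => <-.
  by congr (K _ _); apply: val_inj.
have Kdl : dlsubmx K = 0 by rewrite -[K]Ksym -trmx_ursub Kur trmx0.
have Kul : ulsubmx K = a%:M.
  apply/matrixP => i j; rewrite !ord1.
  have /rowP/(_ 0) := K0; rewrite !mxE/= mulr1 => <-.
  by congr (K _ _); apply: val_inj.
have Kdr : (drsubmx K)^T = drsubmx K by rewrite trmx_drsub Ksym.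
have [Q [d [QQ Kd]]] := IHn _ Kdr.
pose Q1 : 'M[R]_(1 + n) := block_mx 1%:M 0 0 Q.
pose d1 : 'rV[R]_(1 + n) := row_mx a%:M d.
have Q1Q1 : Q1 *m Q1^T = 1%:M.
  rewrite tr_block_mx mulmx_block !trmx0 trmx1 !(mulmx0, mul0mx, mulmx1).
  by rewrite QQ !(addr0, add0r) -scalar_mx_block.
have KQ : K = Q1^T *m diag_mx d1 *m Q1.
  rewrite diag_mx_row tr_block_mx !mulmx_block !trmx0 trmx1.
  rewrite !(mulmx0, mul0mx, mulmx1, mul1mx, addr0, add0r) -Kd.
  rewrite -[LHS]submxK Kur Kdl Kul; congr block_mx.
  by apply/matrixP => i j; rewrite !ord1 !mxE.
exists (Q1 *m H), d1; split.
  by rewrite trmx_mul mulmxA -(mulmxA Q1) HH mulmx1 Q1Q1.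
rewrite trmx_mul !mulmxA -!(mulmxA H^T) !mulmxA.
rewrite -(mulmxA H^T) -(mulmxA H^T) -KQ KE.
by rewrite !mulmxA HTH mul1mx -mulmxA HTH mulmx1.
Qed.

Lemma char_poly_orthogonal_diag n (Q : 'M[R]_n) (d : 'rV[R]_n) :
  Q *m Q^T = 1%:M ->
  char_poly (Q^T *m diag_mx d *m Q) = \prod_(i < n) ('X - (d 0 i)%:P).
Proof.
move=> QQ; have QTQ : Q^T *m Q = 1%:M by exact: mulmx1C.
have QQp : map_mx polyC Q^T *m map_mx polyC Q = 1%:M.
  by rewrite -map_mxM QTQ map_mx1.
transitivity (char_poly (diag_mx d)); last first.
  rewrite (char_poly_trig (diag_mx_is_trig d)).
  by apply: eq_bigr => i _; rewrite !mxE eqxx mulr1n.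
rewrite /char_poly /char_poly_mx !map_mxM.
have {1}-> : 'X%:M =
    map_mx polyC Q^T *m 'X%:M *m map_mx polyC Q :> 'M[{poly R}]_n.
  by rewrite mul_mx_scalar -scalemxAl QQp scalemx1.
rewrite -mulmxBl -mulmxBr !det_mulmx mulrAC -det_mulmx QQp det1 mul1r//.
Qed.

End RealSpectral.

(** * Singular values *)

Section SVD.
Variable R : realType.

(** [rootsR] lists every root once, so occurrences can be counted: the multiplicity of x as a root
    of the product is its number of occurrences in [s]. *)
Lemma perm_rootsR_mult (s : seq R) :
  perm_eq (rootsR_mult (\prod_(x <- s) ('X - x%:P))) s.
Proof.
set p := \prod_(_ <- _) _.
have p0 : p != 0 by rewrite monic_neq0 ?monic_prod_XsubC.
have uR : uniq (rootsR p) by exact: uniq_roots.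
apply/allP => x _ /=; apply/eqP.
rewrite -[in RHS]mu_prod_XsubC -/p /rootsR_mult count_flatten -map_comp.
have -> : [seq (count_mem x \o (fun l => nseq (mup l p) l)) l | l <- rootsR p]
        = [seq (if l == x then mup x p else 0)%N | l <- rootsR p].
  apply: eq_map => l /=; rewrite count_nseq /=; case: eqP => [->|_] //.
  by rewrite mul1n.
have [xr|xr] := boolP (x \in rootsR p).
  rewrite sumnE big_map (big_rem x)//= eqxx big_seq big1 ?addn0// => y.
  by rewrite mem_rem_uniq// inE => /andP[/negbTE ->].
rewrite mupNroot; last by move: xr; rewrite -roots_on_rootsR.
rewrite sumnE big_map big_seq big1// => y yr.
by rewrite ifN//; apply: contraNneq xr => <-.
Qed.

(** Compressed to the chosen rows of [Q], M^T M becomes an invertible diagonal matrix of size k, and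
    a product has at most the rank of each factor. *)
Lemma le_rank_orthogonal m n k (M : 'M[R]_(m, n)) (Q : 'M[R]_n) (d : 'rV[R]_n)
    (f : 'I_k -> 'I_n) : injective f ->
  Q *m Q^T = 1%:M -> M^T *m M = Q^T *m diag_mx d *m Q ->
  (forall j, d 0 (f j) != 0) -> (k <= \rank M)%N.
Proof.
move=> f_inj QQ MM df.
pose E := rowsub f Q.
have EME : E *m (M^T *m M) *m E^T = diag_mx (\row_j d 0 (f j)).
  have -> : E = rowsub f 1%:M *m Q by rewrite mul_rowsub_mx mul1mx.
  rewrite MM trmx_mul !mulmxA -(mulmxA _ Q Q^T) QQ mulmx1.
  rewrite -(mulmxA _ Q Q^T) QQ mulmx1 mul_rowsub_mx mul1mx.
  apply/matrixP => i j; rewrite !mxE (bigD1 (f j))//= big1 => [|l lj].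
    rewrite !mxE eqxx mulr1 addr0.
    by rewrite (inj_eq f_inj); case: eqP => [->|].
  by rewrite !mxE (eq_sym (f j)) (negbTE lj) mulr0.
have rk : \rank (diag_mx (\row_j d 0 (f j))) = k.
  apply/eqP; rewrite -[_ == _]/(row_free _) row_free_unit unitmxE det_diag.
  rewrite unitfE.
  by apply/prodf_neq0 => j _; rewrite mxE.
rewrite -[leqLHS]rk -EME; apply: leq_trans (mxrankM_maxl _ _) _.
by apply: leq_trans (mxrankM_maxr _ _) (mxrankM_maxr _ _).
Qed.

Lemma row_mulmx_col m n p (X : 'M[R]_(m, n)) (Y : 'M[R]_(n, p)) i j :
  row i (X *m col j Y) 0 0 = (X *m Y) i j.
Proof.
by rewrite [LHS]mxE [LHS]mxE [RHS]mxE; apply: eq_bigr => l _; rewrite !mxE.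
Qed.

Lemma dotv_mulmx_row m n (M : 'M[R]_(m, n)) (Q : 'M[R]_n) (d : 'rV[R]_n) i j :
  Q *m Q^T = 1%:M -> M^T *m M = Q^T *m diag_mx d *m Q ->
  dotv (M *m (row i Q)^T) (M *m (row j Q)^T) = d 0 i *+ (i == j).
Proof.
move=> QQ MM; have /matrixP/(_ i j) : Q *m (M^T *m M) *m Q^T = diag_mx d.
  by rewrite MM !mulmxA QQ mul1mx -mulmxA QQ mulmx1.
rewrite [in RHS]mxE => <-; rewrite dotv_mulmxl dotvE trmxK.
rewrite tr_row !mulmxA -!row_mul.
by rewrite row_mulmx_col.
Qed.

(** The interface to singular values: no later proof unfolds the list of roots that defines them.
    The rows of [Q] are right singular vectors, in matching order. *)
Theorem singval_spectral m n (M : 'M[R]_(m, n)) : exists Q : 'M[R]_n,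
  [/\ Q *m Q^T = 1%:M,
      M^T *m M = Q^T *m diag_mx (\row_i singval M i ^+ 2) *m Q,
      forall k, 0 <= singval M k,
      {homo singval M : i j / (i <= j)%N >-> j <= i} &
      forall k, (\rank M <= k)%N -> singval M k = 0].
Proof.
have MMsym : (M^T *m M)^T = M^T *m M by rewrite trmx_mul trmxK.
have [P [d [PP MM]]] := symmetric_spectral MMsym.
have PMMP : P *m (M^T *m M) *m P^T = diag_mx d.
  by rewrite MM !mulmxA PP mul1mx -mulmxA PP mulmx1.
have d_ge0 i : 0 <= d 0 i.
  have := dotvv_ge0 (M *m (row i P)^T).
  by rewrite (dotv_mulmx_row _ _ PP MM) eqxx.
pose s := sort >=%R
  [seq Num.sqrt l | l <- rootsR_mult (char_poly (M^T *m M))].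
pose t := [tuple Num.sqrt (d 0 i) | i < n].
(* The sorted list rearranges the square roots of [d] by [p]; the rows of [P] are rearranged alike
   to give [Q]. *)
have /tuple_permP[p sp] : perm_eq s t.
  rewrite perm_sort /t /= -/(codom _).
  rewrite -[X in perm_eq _ X]/(map (Num.sqrt \o d 0) (enum 'I_n)) map_comp.
  apply: perm_map; rewrite MM char_poly_orthogonal_diag//.
  have -> : \prod_(i < n) ('X - (d 0 i)%:P) =
      \prod_(x <- map (d 0) (enum 'I_n)) ('X - x%:P).
    by rewrite big_map big_enum.
  exact: perm_rootsR_mult.
have size_s : size s = n by rewrite sp size_tuple.
have sE (i : 'I_n) : s`_i = Num.sqrt (d 0 (p i)).
  by rewrite sp -(tnth_nth 0 _ i) !tnth_mktuple.
have s_ge0 k : 0 <= s`_k.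
  have [kn|kn] := ltnP k n; last by rewrite nth_default ?size_s.
  by rewrite (sE (Ordinal kn)) sqrtr_ge0.
have s_homo i j : (i <= j)%N -> s`_j <= s`_i.
  move=> ij; have [jn|jn] := ltnP j n; last first.
    by rewrite [s`_j]nth_default ?size_s.
  have ss : sorted >=%R s by apply: sort_sorted => x y; exact: ge_total.
  apply: (sorted_leq_nth _ _ _ ss) => //; rewrite ?inE ?size_s//.
  - by move=> x y z; exact: ge_trans.
  - by move=> x; exact: lexx.
  - exact: leq_ltn_trans ij jn.
pose Q := perm_mx p *m P.
have QQ : Q *m Q^T = 1%:M.
  rewrite trmx_mul mulmxA -(mulmxA _ P) PP mulmx1 tr_perm_mx -perm_mxM.
  by rewrite fingroup.mulgV perm_mx1.
have QTQ : Q^T *m Q = 1%:M by exact: mulmx1C.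
have QMMQ : Q *m (M^T *m M) *m Q^T = diag_mx (\row_(i < n) s`_i ^+ 2).
  have -> : Q *m (M^T *m M) *m Q^T =
      perm_mx p *m (P *m (M^T *m M) *m P^T) *m (perm_mx p)^T.
    by rewrite trmx_mul !mulmxA.
  rewrite PMMP tr_perm_mx -row_permE -col_permE; apply/matrixP => k l.
  by rewrite !mxE (inj_eq perm_inj) sE sqr_sqrtr.
move: Q QQ QTQ QMMQ => Q QQ QTQ QMMQ.
have MMQ : M^T *m M = Q^T *m diag_mx (\row_(i < n) s`_i ^+ 2) *m Q.
  by rewrite -QMMQ !mulmxA QTQ mul1mx -mulmxA QTQ mulmx1.
have s_rank k : (\rank M <= k)%N -> s`_k = 0.
  move=> rk; have [kn|kn] := ltnP k n; last by rewrite nth_default ?size_s.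
  (* If s_k is nonzero then so are s_0, ..., s_k, and k + 1 nonzero eigenvalues force the rank above
     k. *)
  apply: contraTeq rk => sk0; rewrite -ltnNge.
  apply: (@le_rank_orthogonal _ _ _ _ Q _ (widen_ord kn) _ QQ MMQ).
    by move=> i j /(congr1 val) /= ij; exact: val_inj.
  move=> j; rewrite mxE expf_eq0 /= gt_eqF//.
  rewrite (lt_le_trans _ (s_homo j k _)) ?leq_ord//.
  by rewrite lt_neqAle eq_sym sk0 s_ge0.
have sM k : singval M k = s`_k.
  rewrite /singval /singvals -/s; have [kmn|kmn] := ltnP k (minn m n).
    by rewrite nth_take.
  rewrite nth_default; last by rewrite size_takel ?size_s ?geq_minr.
  have [kn|kn] := ltnP k n; last by rewrite nth_default ?size_s.
  (* The entries dropped by [take] have index at least m, hence at least the rank, so they are 0. *)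
  rewrite s_rank// (leq_trans (rank_leq_row M))//.
  by move: kmn; rewrite geq_min => /orP[//|]; rewrite leqNgt kn.
exists Q; split=> //.
- by rewrite MMQ; congr (_ *m diag_mx _ *m _); apply/rowP => i; rewrite !mxE sM.
- by move=> k; rewrite sM.
- by move=> i j ij; rewrite !sM s_homo.
- by move=> k rk; rewrite sM s_rank.
Qed.

End SVD.

(** * Extremal properties of singular values and trace duality *)

Section SingularValueBounds.
Variable R : realType.
Implicit Types m n : nat.

Lemma singval_ge0 m n (M : 'M[R]_(m, n)) k : 0 <= singval M k.
Proof. by have [Q []] := singval_spectral M. Qed.

Lemma singval_rank m n (M : 'M[R]_(m, n)) k :
  (\rank M <= k)%N -> singval M k = 0.
Proof. by have [Q [_ _ _ _ +]] := singval_spectral M; exact. Qed.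

Lemma dotv_mulmx_diag m n (M : 'M[R]_(m, n)) (Q : 'M[R]_n) (d : 'rV[R]_n) u :
  M^T *m M = Q^T *m diag_mx d *m Q ->
  dotv (M *m u) (M *m u) = \sum_i d 0 i * (Q *m u) i 0 ^+ 2.
Proof.
move=> MM; rewrite dotv_mulmxl mulmxA MM -mulmxA -mulmxA -dotv_mulmxl.
rewrite mul_diag_mx.
by apply: eq_bigr => i _; rewrite [in X in _ * X]mxE; ring.
Qed.

Lemma norm2_mulmx_le m n (M : 'M[R]_(m, n)) u :
  norm2 (M *m u) <= spnorm M * norm2 u.
Proof.
have [Q [QQ MM s_ge0 s_homo _]] := singval_spectral M.
rewrite -ler_sqr ?nnegrE ?mulr_ge0 ?norm2_ge0 ?singval_ge0//.
rewrite exprMn -(norm2_orthogonal u (mulmx1C QQ)) !norm2_sqr.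
rewrite (dotv_mulmx_diag _ MM).
rewrite mulr_sumr; apply: ler_sum => i _; rewrite mxE -expr2.
apply: ler_wpM2r; first exact: sqr_ge0.
by rewrite ler_sqr ?nnegrE ?singval_ge0//; exact: s_homo.
Qed.

(** For n <= m the last singular value belongs to the smallest of all n eigenvalues of M^T M; for m
    < n the kernel could violate the bound. *)
Lemma sigma_min_le m n (M : 'M[R]_(m, n)) u : (n <= m)%N ->
  sigma_min M * norm2 u <= norm2 (M *m u).
Proof.
move=> nm; have [Q [QQ MM s_ge0 s_homo _]] := singval_spectral M.
rewrite -ler_sqr ?nnegrE ?mulr_ge0 ?norm2_ge0 ?singval_ge0//.
rewrite exprMn -(norm2_orthogonal u (mulmx1C QQ)) !norm2_sqr.
rewrite (dotv_mulmx_diag _ MM).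
rewrite mulr_sumr; apply: ler_sum => i _; rewrite [in leRHS]mxE -expr2.
apply: ler_wpM2r; first exact: sqr_ge0.
rewrite ler_sqr ?nnegrE ?singval_ge0//.
by apply: s_homo; rewrite (minn_idPr nm); case: i => i /=; case: (n).
Qed.

Lemma spnorm_attained m n (M : 'M[R]_(m, n)) : (0 < n)%N ->
  exists2 q : 'cV[R]_n, norm2 q = 1 & norm2 (M *m q) = spnorm M.
Proof.
move=> n_gt0; have [Q [QQ MM s_ge0 s_homo _]] := singval_spectral M.
exists (row (Ordinal n_gt0) Q)^T; first exact: norm2_row_orthogonal.
rewrite /norm2 (dotv_mulmx_row _ _ QQ MM) eqxx mxE mulr1n sqrtr_sqr.
by rewrite ger0_norm.
Qed.

Lemma spnorm_ge0 m n (M : 'M[R]_(m, n)) : 0 <= spnorm M.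
Proof. exact: singval_ge0. Qed.

Lemma spnorm_le m n (M : 'M[R]_(m, n)) c : (0 < n)%N ->
  (forall u, norm2 (M *m u) <= c * norm2 u) -> spnorm M <= c.
Proof.
by move=> /(spnorm_attained M)[q q1 <-] /(_ q); rewrite q1 mulr1.
Qed.

Lemma spnorm_gt0 m n (M : 'M[R]_(m, n)) : M != 0 -> 0 < spnorm M.
Proof.
move=> M0; rewrite lt0r spnorm_ge0 andbT; apply: contraNneq M0 => M0.
apply/eqP/matrixP => i j.
have : norm2 (M *m delta_mx j 0) <= 0.
  by rewrite (le_trans (norm2_mulmx_le _ _))// M0 mul0r.
rewrite -colE => c0; have /eqP : norm2 (col j M) = 0.
  by apply/eqP; rewrite eq_le c0 norm2_ge0.
by rewrite norm2_eq0 => /eqP/colP/(_ i); rewrite !mxE.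
Qed.

Lemma sigma_min_attained m n (M : 'M[R]_(m, n)) : (0 < n <= m)%N ->
  exists2 q : 'cV[R]_n, norm2 q = 1 & M^T *m M *m q = sigma_min M ^+ 2 *: q.
Proof.
case/andP=> n_gt0 nm; have [Q [QQ MM s_ge0 s_homo _]] := singval_spectral M.
have pn : (n.-1 < n)%N by rewrite prednK.
exists (row (Ordinal pn) Q)^T; first exact: norm2_row_orthogonal.
rewrite /sigma_min (minn_idPr nm) MM -!mulmxA.
have -> : Q *m (row (Ordinal pn) Q)^T = delta_mx (Ordinal pn) 0.
  by rewrite tr_row !colE mulmxA QQ mul1mx.
rewrite mul_diag_mx tr_row colE scalemxAr; congr (_ *m _).
apply/colP => i; rewrite !mxE eqxx andbT.
by case: eqP => [->|]; rewrite ?mulr0.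
Qed.

Lemma sigma_min_gt0 m n (M : 'M[R]_(m, n)) : (0 < n)%N -> \rank M = n ->
  0 < sigma_min M.
Proof.
move=> n_gt0 rM; have nm : (n <= m)%N by rewrite -rM rank_leq_row.
have [|q q1 Mq] := @sigma_min_attained m n M; first by rewrite n_gt0.
rewrite lt0r singval_ge0 andbT; apply: contra_eq_neq q1 => s0.
suff /eqP -> : q == 0 by rewrite norm2_0 eq_sym oner_eq0.
have Mq0 : M *m q = 0.
  apply/eqP; rewrite -dotvv_eq0 dotv_mulmxl mulmxA Mq s0 expr0n scale0r.
  by rewrite dotvE mulmx0 mxE.
have : row_free M^T by rewrite /row_free mxrank_tr rM.
by rewrite -trmx_eq0 => /mulmx_free_eq0 <-; rewrite -trmx_mul Mq0 trmx0.
Qed.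

(** The trace is taken in the basis of right singular vectors q_i of M, where |M q_i| is the i-th
    singular value, and Cauchy-Schwarz is applied to each term. *)
Lemma mxtrace_mul_le m n (D M : 'M[R]_(m, n)) :
  \tr (D^T *m M) <= spnorm D * \sum_(i < n) singval M i.
Proof.
have [Q [QQ MM s_ge0 _ _]] := singval_spectral M.
have -> : \tr (D^T *m M) = \sum_i dotv (D *m (row i Q)^T) (M *m (row i Q)^T).
  rewrite -[D^T *m M]mulmx1 -(mulmx1C QQ) mulmxA mxtrace_mulC.
  apply: eq_bigr => i _; rewrite dotv_mulmxl dotvE trmxK tr_row.
  by rewrite !mulmxA -!row_mul row_mulmx_col.
rewrite mulr_sumr; apply: ler_sum => i _; apply: le_trans (dotv_le_norm2 _ _) _.
rewrite {2}/norm2 (dotv_mulmx_row _ _ QQ MM) eqxx mxE mulr1n sqrtr_sqr.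
rewrite ger0_norm// ler_wpM2r//.
by rewrite (le_trans (norm2_mulmx_le _ _))// norm2_row_orthogonal// mulr1.
Qed.

(* The partial isometry of the polar decomposition; 0^-1 = 0 makes the
   singular directions of value 0 drop out. *)
Lemma mxtrace_mul_attained m n (M : 'M[R]_(m, n)) : (0 < n)%N ->
  exists2 D : 'M[R]_(m, n), spnorm D <= 1 &
    \tr (D^T *m M) = \sum_(i < n) singval M i.
Proof.
move=> n_gt0; have [Q [QQ MM s_ge0 _ _]] := singval_spectral M.
pose S : 'rV[R]_n := \row_i (singval M i)^-1.
have QMMQ : Q *m (M^T *m M) *m Q^T = diag_mx (\row_i singval M i ^+ 2).
  by rewrite MM !mulmxA QQ mul1mx -mulmxA QQ mulmx1.
exists (M *m Q^T *m diag_mx S *m Q).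
  (* The matrix is isometric on the singular directions of nonzero value and kills the others, so
     its Gram matrix is an orthogonal projector. *)
  have DD : (M *m Q^T *m diag_mx S *m Q)^T *m (M *m Q^T *m diag_mx S *m Q) =
            Q^T *m diag_mx (\row_i (singval M i != 0)%:R) *m Q.
    rewrite !trmx_mul !trmxK tr_diag_mx !mulmxA.
    rewrite -(mulmxA _ Q M^T) -(mulmxA _ (Q *m M^T) M) -(mulmxA _ _ Q^T).
    rewrite -(mulmxA Q) QMMQ; congr (_ *m _); rewrite -!mulmxA; congr (_ *m _).
    rewrite !mulmx_diag; congr diag_mx; apply/rowP => i; rewrite !mxE.
    have [->|s0] := eqVneq (singval M i) 0; first by rewrite invr0 !mul0r.
    by rewrite /=; field.
  apply: spnorm_le => // u; rewrite mul1r norm2_le (dotv_mulmx_diag _ DD).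
  rewrite -norm2_sqr -(norm2_orthogonal u (mulmx1C QQ)) norm2_sqr.
  apply: ler_sum => i _; rewrite mxE -expr2.
  by case: eqP; rewrite ?mul1r// mul0r sqr_ge0.
rewrite !trmx_mul trmxK tr_diag_mx -!mulmxA mxtrace_mulC -mulmxA QMMQ.
rewrite mulmx_diag mxtrace_diag; apply: eq_bigr => i _; rewrite !mxE.
have [->|s0] := eqVneq (singval M i) 0; first by rewrite invr0 mul0r.
by field.
Qed.

(** Used with p = 0 for the nuclear norm and p = 1 for the squared Frobenius norm; the shifted
    exponent makes zero singular values contribute 0. For n = 1 the second term vanishes because the
    rank is at most 1. *)
Lemma sum_rank_le2 m n (M : 'M[R]_(m, n)) p : (0 < n)%N -> (\rank M <= 2)%N ->
  \sum_(i < n) singval M i ^+ p.+1 = singval M 0 ^+ p.+1 + singval M 1 ^+ p.+1.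
Proof.
move=> n_gt0 rM; case: n n_gt0 M rM => [//|[|n]] _ M rM.
  rewrite big_ord1 (singval_rank (rank_leq_col M)).
  by rewrite expr0n addr0.
rewrite !big_ord_recl /= big1 ?addr0// => i _; rewrite singval_rank ?expr0n//.
exact: leq_trans rM _.
Qed.

Lemma sum_singval_sqr m n (M : 'M[R]_(m, n)) :
  \sum_(i < n) singval M i ^+ 2 = \tr (M^T *m M).
Proof.
have [Q [QQ -> _ _ _]] := singval_spectral M.
rewrite -mulmxA mxtrace_mulC -mulmxA QQ mulmx1 mxtrace_diag.
by apply: eq_bigr => i _; rewrite mxE.
Qed.

End SingularValueBounds.

(** * Derivative of the least-squares solution *)

Section MaxNorm.
Variable R : realType.
Implicit Types m n k : nat.

Lemma entry_le_mx_norm m n (M : 'M[R]_(m, n)) i j : `|M i j| <= `|M|.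
Proof.
rewrite [leRHS]/Num.norm /= mx_normrE.
exact: (le_bigmax _ (fun ij : 'I_m * 'I_n => `|M ij.1 ij.2|) (i, j)).
Qed.

Lemma mx_norm_le_norm2 k (u : 'cV[R]_k) : `|u| <= norm2 u.
Proof.
rewrite [leLHS]/Num.norm /= mx_normrE; apply/bigmax_leP; split=> [|[i j] _ /=].
  exact: norm2_ge0.
rewrite ord1 -ler_sqr ?nnegrE ?norm2_ge0// norm2_sqr real_normK ?num_real//.
rewrite /dotv (bigD1 i)//= -expr2 lerDl sumr_ge0// => l _.
by rewrite -expr2 sqr_ge0.
Qed.

(** The factor k in place of sqrt k is crude, but only the equivalence of the two norms matters. *)
Lemma norm2_le_entry k (u : 'cV[R]_k) (a : R) : 0 <= a ->
  (forall i, `|u i 0| <= a) -> norm2 u <= k%:R * a.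
Proof.
move=> a0 ua; rewrite -ler_sqr ?nnegrE ?mulr_ge0 ?norm2_ge0//.
rewrite norm2_sqr; apply: (@le_trans _ _ (\sum_(i < k) a ^+ 2)).
  apply: ler_sum => i _; rewrite -expr2 -[leLHS]real_normK ?num_real//.
  by rewrite ler_sqr ?nnegrE.
rewrite sumr_const card_ord -(mulr_natl (a ^+ 2)) exprMn.
apply: ler_wpM2r; first exact: sqr_ge0.
rewrite -natrX ler_nat.
by case: k {u ua} => // k; rewrite leq_pmulr.
Qed.

Lemma norm2_mulmx_le_mx_norm m n (M : 'M[R]_(m, n)) u :
  norm2 (M *m u) <= m%:R * n%:R * `|M| * norm2 u.
Proof.
rewrite -!mulrA; apply: norm2_le_entry => [|i].
  by rewrite !mulr_ge0 ?norm2_ge0.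
have -> : (M *m u) i 0 = dotv (row i M)^T u.
  by rewrite mxE; apply: eq_bigr => j _; rewrite !mxE.
apply: le_trans (Cauchy_Schwarz _ _) _; rewrite mulrA ler_wpM2r ?norm2_ge0//.
by apply: norm2_le_entry => // j; rewrite !mxE entry_le_mx_norm.
Qed.

Lemma mx_norm_tr m n (M : 'M[R]_(m, n)) : `|M^T| = `|M|.
Proof.
apply/eqP; rewrite eq_le; apply/andP.
by split; rewrite [leLHS]/Num.norm /= mx_normrE; apply/bigmax_leP;
  split=> // -[i j] _ /=; [rewrite mxE | rewrite -[M]trmxK mxE trmxK];
  exact: entry_le_mx_norm.
Qed.

Lemma continuous_linear_norm2 m n k (f : {linear 'M[R]_(m, n) -> 'cV[R]_k}) c :
  (forall h, norm2 (f h) <= c * `|h|) -> continuous f.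
Proof.
move=> fc; apply: bounded_linear_continuous; apply/bounded_funP => r.
exists (`|c| * r) => h hr; apply: le_trans (mx_norm_le_norm2 _) _.
apply: le_trans (fc h) _; apply: le_trans (ler_norm _) _.
by rewrite normrM normr_id ler_wpM2l.
Qed.

End MaxNorm.

(* [e] bounds the change of the solution and [N] the remainder of its
   first-order expansion, for a perturbation of size [t]. *)
Lemma perturbation_bootstrap (R : realFieldType) (kp al X B t e N : R) :
  0 <= kp -> 0 <= al -> 0 <= X -> 0 <= B -> 0 <= t -> 0 <= e -> t <= 1 ->
  t * (2 * kp * (2 * al + 1)) <= 1 ->
  e <= kp * (t * (B + (al + t) * (X + e)) + al * (t * (X + e))) ->
  N <= kp * (t * (t * (X + e) + al * e) + al * (t * e)) ->
  N <= kp * (X + (1 + 2 * al) * (2 * kp * (B + (2 * al + 1) * X))) * t ^+ 2.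
Proof.
move=> kp0 al0 X0 B0 t0 e0 t1 tD He HN.
set C1 := 2 * kp * (B + (2 * al + 1) * X).
have kt0 : 0 <= kp * t by exact: mulr_ge0.
(* [He] has e on both sides; its coefficient on the right is at most kp t (2 al + 1) <= 1/2, so it
   is absorbed and the constant doubles. *)
have eC : e <= C1 * t.
  have h1 : 0 <= (kp * t) * ((1 - t) * (X + e)).
    by rewrite mulr_ge0// mulr_ge0 ?subr_ge0// addr_ge0.
  have h2 : 0 <= (1 - t * (2 * kp * (2 * al + 1))) * e.
    by rewrite mulr_ge0// subr_ge0.
  rewrite /C1; lra.
have C10 : 0 <= C1.
  by rewrite mulr_ge0 ?mulr_ge0// addr_ge0// mulr_ge0// addr_ge0// mulr_ge0.
have eC' : e <= C1 by rewrite (le_trans eC)// -[leRHS]mulr1 ler_wpM2l.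
(* In the remainder e is bounded by C1 where t^2 is already present and by C1 t elsewhere. *)
have h1 : 0 <= kp * t ^+ 2 * (C1 - e).
  by rewrite mulr_ge0 ?subr_ge0// mulr_ge0 ?exprn_ge0.
have h2 : 0 <= kp * t * (2 * al) * (C1 * t - e).
  by rewrite mulr_ge0 ?subr_ge0// mulr_ge0// mulr_ge0.
lra.
Qed.

(** * Differentiation through the perturbed normal equations *)

Section LeastSquaresDerivative.
Variable R : realType.
Variables m n : nat.
Implicit Types (A h : 'M[R]_(m, n)) (b : 'cV[R]_m).

Lemma gram_unitmx A : (forall u : 'cV[R]_n, A *m u = 0 -> u = 0) ->
  A^T *m A \in unitmx.
Proof.
move=> inj; rewrite -row_free_unit -kermx_eq0; apply/eqP/row_matrixP => i.
rewrite row0; apply: trmx_inj; rewrite trmx0; apply: inj; apply/eqP.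
rewrite -dotvv_eq0 dotv_mulmxl dotvE trmxK.
have /(congr1 (row i)) := mulmx_ker (A^T *m A).
rewrite row_mul row0 => /(congr1 (fun X => X *m (row i (kermx (A^T *m A)))^T)).
by rewrite mul0mx !mulmxA => ->; rewrite mxE.
Qed.

Lemma lsq_normal A b : A^T *m A \in unitmx ->
  A^T *m (A *m lsq A b) = A^T *m b.
Proof. by move=> uA; rewrite mulmxA /lsq -(mulmxA (invmx _)) mulKVmx. Qed.

Definition dlsq A b h : 'cV[R]_n :=
  invmx (A^T *m A) *m
    (h^T *m (b - A *m lsq A b) - A^T *m (h *m lsq A b)).

Lemma dlsq_is_linear A b : linear (dlsq A b).
Proof.
move=> a h k; rewrite /dlsq.
rewrite (_ : (a *: h + k)^T = a *: h^T + k^T); last by rewrite linearP.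
rewrite scalemxAr -mulmxDr; congr (_ *m _).
rewrite !mulmxDl mulmxDr -!scalemxAl -!scalemxAr scalerBr.
by rewrite opprD addrACA.
Qed.

HB.instance Definition _ A b :=
  GRing.isLinear.Build R 'M[R]_(m, n) 'cV[R]_n _
    (dlsq A b) (dlsq_is_linear A b).

(* Exact, with the perturbed solution x' on the right: subtract A^T A x = A^T b
   from (A + h)^T (A + h) x' = (A + h)^T b. *)
Lemma lsq_perturbation A h b :
  A^T *m A \in unitmx -> (A + h)^T *m (A + h) \in unitmx ->
  let x' := lsq (A + h) b in
  x' - lsq A b = invmx (A^T *m A) *m
    (h^T *m (b - (A + h) *m x') - A^T *m (h *m x')).
Proof.
move=> uA uAh x'; rewrite -[LHS](mulKmx uA); congr (_ *m _).
have := lsq_normal b uAh; rewrite -/x' linearD/= !mulmxDl !mulmxDr.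
rewrite mulmxN -!mulmxA (lsq_normal _ uA) mulmxN mulmxDr.
move: (A^T *m (A *m x')) (A^T *m (h *m x')) (h^T *m (A *m x')).
move: (h^T *m (h *m x')) (A^T *m b) (h^T *m b) => c4 p q c1 c2 c3.
move=> /matrixP E; apply/matrixP => i j; have := E i j; rewrite !mxE.
lra.
Qed.

(** The bound by [s] is quantitative injectivity: an [h] of operator norm below [s] leaves A + h
    injective, so the normal equations determine the solution there too. *)
Lemma lsq_remainder A b s : 0 < s ->
  (forall u, s * norm2 u <= norm2 (A *m u)) ->
  exists C, \forall h \near (0 : 'M[R]_(m, n)),
    norm2 (lsq (A + h) b - lsq A b - dlsq A b h) <= C * `|h| ^+ 2.
Proof.
move=> s0 sA.
have uA : A^T *m A \in unitmx.
  apply: gram_unitmx => u Au0; apply/eqP; rewrite -norm2_eq0.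
  have := sA u; rewrite Au0 norm2_0 pmulr_rle0// => u0.
  by rewrite eq_le u0 norm2_ge0.
pose K := invmx (A^T *m A); pose x := lsq A b.
(* c |h| bounds the operator norms of h and h^T, the summand 1 keeping c positive; [al] bounds those
   of A and A^T at once. *)
pose c : R := m%:R * n%:R + 1; pose al := spnorm A + spnorm A^T.
pose kp := spnorm K.
have c0 : 0 < c by rewrite ltr_wpDl ?mulr_ge0.
have al0 : 0 <= al by rewrite addr_ge0 ?spnorm_ge0.
have kp0 : 0 <= kp by exact: spnorm_ge0.
have hA u : norm2 (A *m u) <= al * norm2 u.
  rewrite (le_trans (norm2_mulmx_le _ _))// ler_wpM2r ?norm2_ge0//.
  by rewrite lerDl spnorm_ge0.
have hAT u : norm2 (A^T *m u) <= al * norm2 u.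
  rewrite (le_trans (norm2_mulmx_le _ _))// ler_wpM2r ?norm2_ge0//.
  by rewrite lerDr spnorm_ge0.
pose D := 2 * kp * (2 * al + 1).
have D0 : 0 <= D by rewrite mulr_ge0 ?mulr_ge0// addr_ge0// mulr_ge0.
exists (kp * (norm2 x + (1 + 2 * al) *
  (2 * kp * (norm2 b + (2 * al + 1) * norm2 x))) * c ^+ 2).
have small (d : R) : 0 < d -> \forall h \near (0 : 'M[R]_(m, n)), c * `|h| < d.
  move=> d0; near=> h; rewrite -ltr_pdivlMl//; near: h.
  by apply: (@nbhs0_lt _ 'M[R]_(m, n)); rewrite mulr_gt0// invr_gt0.
near=> h.
pose t := c * `|h|.
have t0 : 0 <= t by rewrite mulr_ge0 // ltW.
have t1 : t < 1 by rewrite /t; near: h; exact: small.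
have ts : t < s by rewrite /t; near: h; exact: small.
(* This gives t D <= 1; the added 1 keeps the threshold positive even if D = 0. *)
have tD : t < (D + 1)^-1.
  by rewrite /t; near: h; apply: small; rewrite invr_gt0 ltr_wpDl.
have hh u : norm2 (h *m u) <= t * norm2 u.
  rewrite (le_trans (norm2_mulmx_le_mx_norm _ _))// ler_wpM2r ?norm2_ge0//.
  by rewrite ler_wpM2r// lerDl.
have hhT u : norm2 (h^T *m u) <= t * norm2 u.
  rewrite (le_trans (norm2_mulmx_le_mx_norm _ _))// ler_wpM2r ?norm2_ge0//.
  by rewrite mx_norm_tr ler_wpM2r// mulrC lerDl.
have uAh : (A + h)^T *m (A + h) \in unitmx.
  apply: gram_unitmx => u Ahu0; apply/eqP; rewrite -norm2_eq0.
  have Au : A *m u = - (h *m u) by apply/eqP; rewrite -addr_eq0 -mulmxDl Ahu0.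
  have := le_trans (sA u) _; rewrite Au norm2N => /(_ _ (hh u)).
  rewrite -subr_ge0 -mulrBl nmulr_rge0 ?subr_lt0// => u0.
  by rewrite eq_le u0 norm2_ge0.
have E := lsq_perturbation b uA uAh; rewrite /= -/x -/K in E.
set x' := lsq (A + h) b in E *; pose e := norm2 (x' - x).
have hK u : norm2 (K *m u) <= kp * norm2 u by exact: norm2_mulmx_le.
have x'le : norm2 x' <= norm2 x + e.
  by rewrite -[x'](subrK x) addrC norm2D.
have e_le : e <=
    kp * (t * (norm2 b + (al + t) * (norm2 x + e)) + al * (t * (norm2 x + e))).
  rewrite {1}/e E (le_trans (hK _))// ler_wpM2l//.
  rewrite (le_trans (norm2D _ _))// norm2N lerD//.
    rewrite (le_trans (hhT _))// ler_wpM2l// (le_trans (norm2D _ _))//.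
    rewrite norm2N lerD2l.
    rewrite mulmxDl (le_trans (norm2D _ _))// mulrDl lerD//.
      by rewrite (le_trans (hA _))// ler_wpM2l.
    by rewrite (le_trans (hh _))// ler_wpM2l.
  rewrite (le_trans (hAT _))// ler_wpM2l// (le_trans (hh _))// ler_wpM2l//.
(* Subtracting the derivative from the exact formula leaves only terms with two small factors, each
   h or x' - x. *)
have rE : lsq (A + h) b - lsq A b - dlsq A b h =
    K *m (- (h^T *m (h *m x' + A *m (x' - x))) - A^T *m (h *m (x' - x))).
  rewrite -/x' -/x [in LHS]E /dlsq -/K -/x -mulmxBr; congr (_ *m _).
  rewrite mulmxDl !(mulmxBr, mulmxDr, mulmxN).
  move: (h^T *m b) (h^T *m (A *m x')) (h^T *m (h *m x')) (h^T *m (A *m x)).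
  move: (A^T *m (h *m x')) (A^T *m (h *m x)) => *.
  apply/matrixP => i j; rewrite !mxE; lra.
rewrite rE -[leRHS]mulrA -exprMn -/t.
apply: (perturbation_bootstrap _ _ _ _ _ _ _ _ e_le) => //.
- exact: norm2_ge0.
- exact: norm2_ge0.
- exact: norm2_ge0.
- exact: ltW.
- rewrite -/D (le_trans (ler_wpM2r D0 (ltW tD)))// mulrC.
  rewrite ler_pdivrMr ?ltr_wpDl//.
  by rewrite mul1r lerDl.
rewrite (le_trans (hK _))// ler_wpM2l//.
rewrite (le_trans (norm2D _ _))// !norm2N lerD//.
  rewrite (le_trans (hhT _))// ler_wpM2l// (le_trans (norm2D _ _))// lerD//.
  by rewrite (le_trans (hh _))// ler_wpM2l.
by rewrite (le_trans (hAT _))// ler_wpM2l.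
Unshelve. all: by end_near. Qed.

Lemma is_diff_lsq A b s : 0 < s -> (forall u, s * norm2 u <= norm2 (A *m u)) ->
  differentiable (fun A' => lsq A' b) A /\
  'd (fun A' => lsq A' b) A = dlsq A b :> ('M[R]_(m, n) -> 'cV[R]_n).
Proof.
move=> s0 sA; have [C HC] := lsq_remainder b s0 sA.
have cL : continuous (dlsq A b).
  pose c := norm2 (b - A *m lsq A b); pose e := norm2 (lsq A b).
  pose K := spnorm (invmx (A^T *m A)).
  apply: (@continuous_linear_norm2 _ _ _ _ _
    (K * (n%:R * m%:R * c + spnorm A^T * (m%:R * n%:R * e)))) => h.
  rewrite -[leRHS]mulrA (le_trans (norm2_mulmx_le _ _))//.
  rewrite ler_wpM2l ?spnorm_ge0//.
  rewrite (le_trans (norm2D _ _))// norm2N mulrDl lerD//.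
    rewrite (le_trans (norm2_mulmx_le_mx_norm _ _))// mx_norm_tr -/c.
    by rewrite [leRHS]mulrAC.
  rewrite (le_trans (norm2_mulmx_le _ _))// -[leRHS]mulrA.
  rewrite ler_wpM2l ?spnorm_ge0//.
  by rewrite (le_trans (norm2_mulmx_le_mx_norm _ _))// [leRHS]mulrAC.
have locL : (fun A' => lsq A' b) \o shift A =
    cst (lsq A b) + dlsq A b +o_ (0 : 'M[R]_(m, n)) id.
  apply/eqaddoP => eps eps0; near=> h.
  have -> : ((fun A' => lsq A' b) \o shift A - (cst (lsq A b) + dlsq A b)) h
            = lsq (A + h) b - lsq A b - dlsq A b h.
    by rewrite -addrA -opprD (addrC A).
  (* The sign of C is unknown, so C is majorised by |C| + 1, which is positive and can be divided
     by. *)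
  have hC : C * `|h| <= eps.
    rewrite (le_trans (ler_norm _))// normrM normr_id.
    rewrite (@le_trans _ _ ((`|C| + 1) * `|h|))//.
      by rewrite ler_wpM2r// lerDl.
    rewrite -ler_pdivlMl ?ltr_wpDl//; near: h.
    by apply: (@nbhs0_le _ 'M[R]_(m, n)); rewrite mulr_gt0// invr_gt0 ltr_wpDl.
  rewrite (le_trans (mx_norm_le_norm2 _))// (@le_trans _ _ (C * `|h| ^+ 2))//.
    by near: h.
  by rewrite expr2 mulrA ler_wpM2r.
have dL := diff_unique cL locL; split=> //.
by apply/diff_locallyP; rewrite dL.
Unshelve. all: by end_near. Qed.

End LeastSquaresDerivative.

(** * Condition numbers *)

Section Maxima.
Variable R : realType.

Lemma has_max_max_of (S : set R) M :
  S M -> ubound S M -> has_max S /\ max_of S = M.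
Proof.
move=> SM uM; split; first by exists M.
apply/eqP; rewrite eq_le; apply/andP; split.
  by apply: ge_sup => //; exists M.
by apply: ub_le_sup => //; exists M.
Qed.

(** The one-sided hypothesis suffices since u and v may be exchanged. Row vectors fit [EVT_max_rV],
    applied in [sphere_max]. *)
Lemma continuous_Lipschitz_norm2 n (f : 'rV[R]_n -> R) c :
  (forall u v, f u <= f v + c * norm2 (u - v)^T) -> continuous f.
Proof.
move=> fc u; pose C := `|c| * n%:R + 1.
have C0 : 0 < C by rewrite ltr_wpDl// mulr_ge0.
have f1 v w : f v - f w <= C * `|v - w|.
  rewrite lerBlDl (le_trans (fc v w))// lerD2l.
  apply: (@le_trans _ _ (`|c| * (n%:R * `|v - w|))).
    rewrite (le_trans (ler_wpM2r (norm2_ge0 _) (ler_norm c)))//.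
    rewrite ler_wpM2l// norm2_le_entry// => i.
    by rewrite (le_trans (entry_le_mx_norm _ _ _))// mx_norm_tr.
  by rewrite mulrA ler_wpM2r// lerDl.
apply/(@cvgrPdist_lt _ _ _ (nbhs u)) => e e0; near=> v.
apply: (@le_lt_trans _ _ (C * `|u - v|)).
  by rewrite ler_norml f1 andbT lerNl opprB (le_trans (f1 _ _))// distrC.
rewrite -ltr_pdivlMl//; near: v.
by apply: cvgr_dist_lt; [exact: cvg_id | rewrite mulr_gt0// invr_gt0].
Unshelve. all: by end_near. Qed.

Lemma norm2_Lipschitz n (u v : 'cV[R]_n) : norm2 u <= norm2 v + norm2 (u - v).
Proof. by rewrite -{1}(subrK v u) addrC norm2D. Qed.

Lemma sphere_max n (f : 'cV[R]_n -> R) c : (0 < n)%N ->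
  (forall u v, f u <= f v + c * norm2 (u - v)) ->
  exists2 u, norm2 u = 1 & forall v, norm2 v = 1 -> f v <= f u.
Proof.
move=> n_gt0 fc; pose S := [set v : 'rV[R]_n | norm2 v^T = 1].
have S0 : S !=set0.
  exists (delta_mx 0 (Ordinal n_gt0)); rewrite /S /= trmx_delta /norm2.
  by rewrite dotvE trmx_delta mul_delta_mx mxE eqxx sqrtr1.
have cS : compact S.
  apply: bounded_closed_compact.
    exists 1; split; first exact: num_real.
    move=> M M1 v Sv; apply: (le_trans _ (ltW M1)).
    by rewrite -mx_norm_tr (le_trans (mx_norm_le_norm2 _))// Sv.
  have cn : continuous (fun v : 'rV[R]_n => norm2 v^T).
    apply: (@continuous_Lipschitz_norm2 _ _ 1) => u v.
    by rewrite mul1r linearB/= norm2_Lipschitz.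
  rewrite (_ : S = (fun v : 'rV[R]_n => norm2 v^T) @^-1` [set 1])//.
  apply: preimage_closed => [v _|]; [exact: cn | exact: closed_eq].
have cf : continuous (fun v : 'rV[R]_n => f v^T).
  by apply: (@continuous_Lipschitz_norm2 _ _ c) => u v; rewrite linearB/= fc.
have [w Sw wmax] := EVT_max_rV S0 cS (continuous_subspaceT cf).
exists w^T; first by rewrite inE in Sw.
by move=> v v1; rewrite -[v]trmxK; apply: wmax; rewrite inE /S /= trmxK.
Qed.

End Maxima.

Section RankTwo.
Variables (R : realType) (m n : nat).

Lemma mxtrace_mul_rank1 (W : 'M[R]_(n, m)) (u : 'cV[R]_m) v :
  \tr (W *m (u *m v^T)) = dotv v (W *m u).
Proof. by rewrite mulmxA mxtrace_mulC trace_mx11 dotvE. Qed.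

Variables (u1 u2 : 'cV[R]_m) (v1 v2 : 'cV[R]_n).
Let M := u1 *m v1^T + u2 *m v2^T.

Lemma rank_rank2 : (\rank M <= 2)%N.
Proof.
rewrite (leq_trans (mxrank_add _ _))// (leq_add (n1 := 1) (n2 := 1))//.
  by rewrite (leq_trans (mxrankM_maxr _ _))// rank_leq_row.
by rewrite (leq_trans (mxrankM_maxr _ _))// rank_leq_row.
Qed.

Lemma mxtrace_rank2 (h : 'M[R]_(m, n)) :
  \tr (h^T *m M) = dotv (h *m v1) u1 + dotv (h *m v2) u2.
Proof. by rewrite mulmxDr linearD/= !mxtrace_mul_rank1 !dotv_mulmxl. Qed.

Lemma mxtrace_rank2_gram : dotv u1 u2 = 0 ->
  \tr (M^T *m M) = dotv u1 u1 * dotv v1 v1 + dotv u2 u2 * dotv v2 v2.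
Proof.
move=> u12.
have Mv w : M *m w = dotv v1 w *: u1 + dotv v2 w *: u2.
  rewrite mulmxDl -!mulmxA [v1^T *m w]mx11_scalar [v2^T *m w]mx11_scalar.
  by rewrite !mul_mx_scalar !dotvE.
rewrite mxtrace_rank2 !Mv !(dotvDl, dotvZl) (dotvC u2 u1) u12.
ring.
Qed.

End RankTwo.

Section ConditionNumbers.
Variables (R : realType) (m n : nat) (n_gt0 : (0 < n)%N).
Variables (A : 'M[R]_(m, n)) (b : 'cV[R]_m) (fullA : \rank A = n).

Let K := invmx (A^T *m A).
Let x := lsq A b.
Let r := b - A *m x.
Let s := sigma_min A.

Let nm : (n <= m)%N. Proof. by rewrite -fullA rank_leq_row. Qed.

Let s_gt0 : 0 < s. Proof. exact: sigma_min_gt0. Qed.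

Let sA u : s * norm2 u <= norm2 (A *m u). Proof. exact: sigma_min_le. Qed.

Let uA : A^T *m A \in unitmx.
Proof.
apply: gram_unitmx => u Au0; apply/eqP; rewrite -norm2_eq0.
have := sA u; rewrite Au0 norm2_0 pmulr_rle0// => u0.
by rewrite eq_le u0 norm2_ge0.
Qed.

Let Ksym : K^T = K.
Proof. by rewrite trmx_inv trmx_mul trmxK. Qed.

Lemma lsq_residual_orthogonal u : dotv r (A *m u) = 0.
Proof.
by rewrite dotv_mulmxr mulmxBr lsq_normal// subrr dotvE trmx0 mul0mx mxE.
Qed.

(** With y = K u, |A y|^2 = <y, u> <= |y| |u| and s |y| <= |A y|; a factor |A y| cancels. *)
Lemma norm2_mul_invgram u : s * norm2 (A *m (K *m u)) <= norm2 u.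
Proof.
set y := K *m u; have Ay2 : norm2 (A *m y) ^+ 2 <= norm2 y * norm2 u.
  rewrite norm2_sqr dotv_mulmxl mulmxA /y mulKVmx//; exact: dotv_le_norm2.
have [->|Ay0] := eqVneq (norm2 (A *m y)) 0; first by rewrite mulr0 norm2_ge0.
have Ay_gt0 : 0 < norm2 (A *m y) by rewrite lt0r Ay0 norm2_ge0.
rewrite -(ler_pM2r Ay_gt0) -mulrA -expr2.
rewrite (le_trans (ler_wpM2l (ltW s_gt0) Ay2))// mulrA (mulrC (norm2 u)).
by rewrite ler_wpM2r ?norm2_ge0// sA.
Qed.

Lemma norm2_invgram u : s ^+ 2 * norm2 (K *m u) <= norm2 u.
Proof.
rewrite expr2 -mulrA (le_trans _ (norm2_mul_invgram u))//.
by rewrite ler_wpM2l ?(ltW s_gt0)// sA.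
Qed.

(** The singular vector for s is extremal for A and K at once; it serves the lower bound on chi_x(A)
    and the maximiser for chi_x(b). *)
Lemma lsq_attained : exists q : 'cV[R]_n,
  [/\ norm2 q = 1, norm2 (A *m q) = s & K *m q = (s ^+ 2)^-1 *: q].
Proof.
have [|q q1 Gq] := @sigma_min_attained _ m n A; first by rewrite n_gt0.
exists q; split => //.
  rewrite /norm2 dotv_mulmxl mulmxA Gq dotvZr -norm2_sqr q1 expr1n mulr1.
  by rewrite sqrtr_sqr ger0_norm// ltW.
rewrite -[in RHS](mulKmx uA q) Gq -scalemxAr scalerA mulVf ?scale1r//.
by rewrite sqrf_eq0 gt_eqF.
Qed.

Lemma rank_rank2_mx dx : (\rank (rank2_mx A b dx) <= 2)%N.
Proof. exact: rank_rank2. Qed.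

Definition nuclear dx :=
  singval (rank2_mx A b dx) 0 + singval (rank2_mx A b dx) 1.

Lemma nuclearE dx : nuclear dx = \sum_(i < n) singval (rank2_mx A b dx) i.
Proof.
have := sum_rank_le2 0 n_gt0 (rank_rank2_mx dx); rewrite !expr1 /nuclear => <-.
by apply: eq_bigr => i _; rewrite expr1.
Qed.

Lemma dotv_dlsq dx h : dotv dx (dlsq A b h) = \tr (h^T *m rank2_mx A b dx).
Proof.
rewrite mxtrace_rank2 /dlsq -/K -/x -/r -{1}Ksym mulmxBr dotvDr !dotvNr.
by rewrite -!dotv_mulmxl -mulmxA (dotvC (h *m x)).
Qed.

Lemma dotv_dlsq_le dx h : dotv dx (dlsq A b h) <= spnorm h * nuclear dx.
Proof. by rewrite dotv_dlsq nuclearE mxtrace_mul_le. Qed.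

Lemma dotv_dlsq_attained dx : exists2 h, spnorm h <= 1 &
  dotv dx (dlsq A b h) = nuclear dx.
Proof.
have [h h1 hM] := mxtrace_mul_attained (rank2_mx A b dx) n_gt0.
by exists h; rewrite // dotv_dlsq nuclearE.
Qed.

Lemma nuclear_ge0 dx : 0 <= nuclear dx.
Proof. by rewrite addr_ge0 ?singval_ge0. Qed.

(** An optimal contraction h turns the sum of singular values into <h v1, u1> + <h v2, u2>, where
    |v1| <= |dx| / s^2 and |u2| <= |dx| / s. *)
Lemma nuclear_le dx : nuclear dx <= s^-1 * (norm2 r / s + norm2 x) * norm2 dx.
Proof.
have [h h1 <-] := dotv_dlsq_attained dx.
have hu u : norm2 (h *m u) <= norm2 u.
  by rewrite (le_trans (norm2_mulmx_le _ _))// ler_piMl ?norm2_ge0.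
rewrite dotv_dlsq mxtrace_rank2 -/x -/r -/K.
have -> : s^-1 * (norm2 r / s + norm2 x) * norm2 dx =
    norm2 dx / s ^+ 2 * norm2 r + norm2 x * (norm2 dx / s).
  by field; rewrite gt_eqF.
apply: lerD; apply: le_trans (dotv_le_norm2 _ _) _.
  rewrite ler_wpM2r ?norm2_ge0// (le_trans (hu _))//.
  by rewrite ler_pdivlMr ?exprn_gt0// mulrC norm2_invgram.
apply: ler_pM; rewrite ?norm2_ge0// norm2N ler_pdivlMr// mulrC -mulmxA.
exact: norm2_mul_invgram.
Qed.

Lemma nuclear_ge : exists2 q, norm2 q = 1 &
  s^-1 * Num.sqrt ((norm2 r / s) ^+ 2 + norm2 x ^+ 2) <= nuclear q.
Proof.
have [q [q1 Aq Kq]] := lsq_attained; exists q => //.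
have s0 : s != 0 by rewrite gt_eqF.
rewrite -ler_sqr ?nnegrE ?nuclear_ge0//; last first.
  by rewrite mulr_ge0 ?sqrtr_ge0 ?invr_ge0 ?(ltW s_gt0).
rewrite exprMn sqr_sqrtr ?addr_ge0 ?sqr_ge0//.
have : \sum_(i < n) singval (rank2_mx A b q) i ^+ 2 <= nuclear q ^+ 2.
  rewrite (sum_rank_le2 1 n_gt0 (rank_rank2_mx q)) /nuclear sqrrD.
  have := mulr_ge0 (singval_ge0 (rank2_mx A b q) 0)
                   (singval_ge0 (rank2_mx A b q) 1).
  lra.
apply: le_trans; rewrite sum_singval_sqr mxtrace_rank2_gram; last first.
  by rewrite dotvNr -mulmxA lsq_residual_orthogonal oppr0.
(* At [q], |v1| = 1 / s^2 and |u2| = 1 / s, so the two sides are equal. *)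
rewrite -/x -/r -/K dotvNl dotvNr opprK -mulmxA Kq -scalemxAr.
rewrite !dotvZl !dotvZr -!norm2_sqr.
rewrite Aq q1 le_eqVlt; apply/orP; left; apply/eqP; field.
by [].
Qed.

(** Continuity comes from duality: a contraction optimal for u gives nuclear u <= nuclear v +
    nuclear (u - v), and [nuclear_le] bounds the last term. *)
Lemma nuclear_max : exists2 u, norm2 u = 1 &
  forall v, norm2 v = 1 -> nuclear v <= nuclear u.
Proof.
apply: (@sphere_max _ _ _ (s^-1 * (norm2 r / s + norm2 x))) => // u v.
have [h h1 <-] := dotv_dlsq_attained u.
rewrite -{1}(subrK v u) dotvDl addrC lerD//.
  by rewrite (le_trans (dotv_dlsq_le _ _))// ler_piMl ?nuclear_ge0.
rewrite (le_trans (dotv_dlsq_le _ _))// (le_trans _ (nuclear_le _))//.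
by rewrite ler_piMl ?nuclear_ge0.
Qed.

Lemma sigma12_max : has_max (sigma12_values A b) /\
  exists u, [/\ norm2 u = 1, max_of (sigma12_values A b) = nuclear u &
                forall v, norm2 v = 1 -> nuclear v <= nuclear u].
Proof.
have [u u1 umax] := nuclear_max.
have [] := @has_max_max_of _ (sigma12_values A b) (nuclear u).
- by exists u.
- by move=> _ [v /= v1 <-]; exact: umax.
by move=> hm mu; split=> //; exists u.
Qed.

Lemma norm2_dlsq_le N h : (forall v, norm2 v = 1 -> nuclear v <= N) ->
  norm2 (dlsq A b h) <= spnorm h * N.
Proof.
(* [q] serves only as some unit vector, whence 0 <= N. *)
move=> hN; have [q [q1 _ _]] := lsq_attained.
have N0 : 0 <= N by rewrite (le_trans (nuclear_ge0 q))// hN.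
move: (dlsq A b h) (fun v => dotv_dlsq_le v h) => y hy.
have [->|] := eqVneq y 0; first by rewrite norm2_0 mulr_ge0 ?spnorm_ge0.
rewrite -norm2_gt0 => ny; have := hy ((norm2 y)^-1 *: y).
rewrite dotvZl -norm2_sqr expr2 mulKf ?gt_eqF// => yle.
apply: le_trans yle _; apply: ler_wpM2l; first exact: spnorm_ge0.
by apply: hN; rewrite norm2Z ger0_norm ?invr_ge0 ?norm2_ge0// mulVf// gt_eqF.
Qed.

Lemma diff_lsq_A : differentiable (fun A' => lsq A' b) A.
Proof. by have [] := is_diff_lsq b s_gt0 sA. Qed.

Lemma diff_lsq_b : differentiable (lsq A) b /\ 'd (lsq A) b = lsq A :> (_ -> _).
Proof.
pose f := mulmx (K *m A^T) : {linear 'cV[R]_m -> 'cV[R]_n}.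
have cf : continuous f.
  apply: (@continuous_linear_norm2 _ _ _ _ f
    (n%:R * m%:R * `|K *m A^T| * m%:R)) => h.
  rewrite (le_trans (norm2_mulmx_le_mx_norm _ _))// -!mulrA !ler_wpM2l//.
  by apply: norm2_le_entry => // i; exact: entry_le_mx_norm.
split; first exact: (@linear_differentiable _ _ _ f).
exact: (@diff_lin _ _ _ f).
Qed.

Lemma condA_max cA cX : 0 < cA -> 0 < cX ->
  has_max (condA_ratios cA cX A b) /\
  condA cA cX A b = cA / cX * max_of (sigma12_values A b).
Proof.
move=> cA0 cX0; have [_ [u [u1 -> umax]]] := sigma12_max.
have [_ dE] := is_diff_lsq b s_gt0 sA.
have ub : ubound (condA_ratios cA cX A b) (cA / cX * nuclear u).
  move=> _ [h /= h0 <-]; rewrite dE; set y := dlsq A b h.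
  have sh : 0 < spnorm h by exact: spnorm_gt0.
  have yh : norm2 y <= spnorm h * nuclear u by exact: norm2_dlsq_le.
  rewrite ler_pdivrMr ?divr_gt0// ler_pdivrMr//.
  rewrite (_ : _ * _ * cX = spnorm h * nuclear u)//.
  by field; rewrite !gt_eqF.
apply: has_max_max_of => //.
have [h h1 hu] := dotv_dlsq_attained u.
have Nle : nuclear u <= norm2 (dlsq A b h).
  by rewrite -hu (le_trans (dotv_le_norm2 _ _))// u1 mul1r.
(* The optimal h may be 0, which the ratios exclude; then nuclear u = 0 and any nonzero matrix
   attains the maximum. *)
have [k k0 kle] : exists2 k : 'M[R]_(m, n), k != 0 &
    cA / cX * nuclear u <= norm2 (dlsq A b k) / cX / (spnorm k / cA).
  have [h0|h0] := eqVneq h 0.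
    have m_gt0 : (0 < m)%N by exact: leq_trans n_gt0 nm.
    exists (const_mx 1).
      apply/eqP => /matrixP/(_ (Ordinal m_gt0) (Ordinal n_gt0)); rewrite !mxE.
      by apply/eqP; exact: oner_neq0.
    have N0 : nuclear u <= 0 by rewrite (le_trans Nle)// h0 linear0 norm2_0.
    apply: (@le_trans _ _ 0); first by rewrite mulr_ge0_le0// divr_ge0// ltW.
    by rewrite !divr_ge0 ?norm2_ge0 ?spnorm_ge0 ?ltW.
  exists h => //; have sh : 0 < spnorm h by exact: spnorm_gt0.
  rewrite ler_pdivlMr ?divr_gt0// ler_pdivlMr//.
  rewrite (_ : _ * _ * cX = spnorm h * nuclear u); last first.
    by field; rewrite !gt_eqF.
  by rewrite (le_trans _ Nle)// ler_piMl ?nuclear_ge0.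
exists k => //=; rewrite dE; apply/eqP; rewrite eq_le kle andbT.
by apply: ub; exists k => //=; rewrite dE.
Qed.

Lemma condb_max cB cX : 0 < cB -> 0 < cX ->
  has_max (condb_ratios cB cX A b) /\ condb cB cX A b = cB / (cX * s).
Proof.
move=> cB0 cX0; have [_ dE] := diff_lsq_b; apply: has_max_max_of.
  (* For the datum A q the solution is q, with |q| = 1 and |A q| = s. *)
  have [q [q1 Aq _]] := lsq_attained; exists (A *m q) => /=.
    by rewrite -norm2_gt0 Aq.
  rewrite dE /lsq -!mulmxA (mulmxA A^T) mulKmx// Aq q1.
  by field; rewrite !gt_eqF.
move=> _ [d /= d0 <-]; rewrite dE; set y := lsq A d.
have nd : 0 < norm2 d by rewrite norm2_gt0.
(* A y is the orthogonal projection of d: |A y|^2 = <A y, d>. *)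
have Ay : norm2 (A *m y) <= norm2 d.
  have [->|Ay0] := eqVneq (A *m y) 0; first by rewrite norm2_0 ltW.
  have nAy : 0 < norm2 (A *m y) by rewrite norm2_gt0.
  rewrite -(ler_pM2l nAy) -expr2 norm2_sqr {1}dotv_mulmxl lsq_normal//.
  rewrite -dotv_mulmxl.
  exact: dotv_le_norm2.
rewrite ler_pdivrMr ?divr_gt0// ler_pdivrMr//.
rewrite (_ : _ * _ * cX = norm2 d / s); last by field; rewrite !gt_eqF.
by rewrite ler_pdivlMr// mulrC (le_trans (sA _)).
Qed.

Lemma condA_bounds cA cX : 0 < cA -> 0 < cX ->
  cA / (cX * s) * Num.sqrt ((norm2 r / s) ^+ 2 + norm2 x ^+ 2)
    <= condA cA cX A b <= cA / (cX * s) * (norm2 r / s + norm2 x).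
Proof.
move=> cA0 cX0; have [_ ->] := condA_max cA0 cX0.
have [_ [u [u1 -> umax]]] := sigma12_max.
have cc : 0 <= cA / cX by rewrite divr_ge0// ltW.
rewrite (_ : cA / (cX * s) = cA / cX * s^-1); last by rewrite invfM mulrA.
rewrite -!(mulrA (cA / cX)); apply/andP; split; apply: ler_wpM2l => //.
  have [q q1 qle] := nuclear_ge; exact: le_trans qle (umax q q1).
by rewrite (le_trans (nuclear_le u))// u1 mulr1.
Qed.

End ConditionNumbers.

(** * The angle between b and the column space *)

Section Angle.
Variables (R : realType) (m n : nat) (n_gt0 : (0 < n)%N).
Variables (A : 'M[R]_(m, n)) (b : 'cV[R]_m) (fullA : \rank A = n).

Let x := lsq A b.
Let r := b - A *m x.

Lemma norm2_sqr_lsq : norm2 b ^+ 2 = norm2 (A *m x) ^+ 2 + norm2 r ^+ 2.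
Proof.
have bE : b = A *m x + r by rewrite addrC subrK.
have := lsq_residual_orthogonal n_gt0 b fullA x; rewrite -/x -/r => rx.
rewrite [in LHS]bE; move: rx.
move: (A *m x) r => p w wp; rewrite !norm2_sqr !(dotvDl, dotvDr) (dotvC p) wp.
by rewrite addr0 add0r.
Qed.

(** The infimum is reached at u = x: b and A x have the same inner product with every A u, so by
    Cauchy-Schwarz no A u makes a larger cosine with b. *)
Lemma lsq_angle_colspace : A *m x != 0 ->
  angle_colspace A b = acos (norm2 (A *m x) / norm2 b).
Proof.
move=> Ax0; have nAx : 0 < norm2 (A *m x) by rewrite norm2_gt0.
have nb : 0 < norm2 b.
  rewrite lt0r norm2_ge0 andbT -sqrf_eq0 norm2_sqr_lsq gt_eqF//.
  by rewrite ltr_pwDl ?sqr_ge0// exprn_gt0.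
have bA u : dotv b (A *m u) = dotv (A *m x) (A *m u).
  rewrite -{1}(subrK (A *m x) b) -/r dotvDl lsq_residual_orthogonal//.
  by rewrite add0r.
have cI (c : R) : `|c| <= 1 -> c \in `[(-1), 1] by rewrite in_itv /= ler_norml.
have bnd (u v : 'cV[R]_m) : u != 0 -> v != 0 ->
    `|dotv u v / (norm2 u * norm2 v)| <= 1.
  rewrite -!norm2_gt0 => u0 v0; rewrite normrM normfV.
  rewrite [X in _ / X]gtr0_norm ?mulr_gt0// ler_pdivrMr ?mulr_gt0// mul1r.
  exact: Cauchy_Schwarz.
have b0 : b != 0 by rewrite -norm2_gt0.
have xE : dotv b (A *m x) / (norm2 b * norm2 (A *m x)) =
    norm2 (A *m x) / norm2 b.
  by rewrite bA -norm2_sqr; field; rewrite !gt_eqF.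
rewrite /angle_colspace; apply/eqP; rewrite eq_le; apply/andP; split.
  apply: ge_inf; last by exists x => //; rewrite /vangle xE.
  exists 0 => _ [u /= Au0 <-]; apply: acos_ge0.
  by have := bnd _ _ b0 Au0; rewrite ler_norml.
apply: lb_le_inf; first by exists (vangle b (A *m x)); exists x.
move=> _ [u /= Au0 <-]; rewrite /vangle.
have nAu : 0 < norm2 (A *m u) by rewrite norm2_gt0.
have i1 := cI _ (bnd _ _ b0 Au0).
have i2 : norm2 (A *m x) / norm2 b \in `[(-1 : R), 1] by rewrite -xE cI// bnd.
(* The angles are compared through [cos], which decreases on [0, pi]. *)
rewrite leNgt -ltr_cos ?in_itv/= ?acos_ge0 ?acos_lepi//; last first.
rewrite !acosK// -leNgt bA ler_pdivrMr ?mulr_gt0//.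
rewrite mulrA divfK ?gt_eqF//; exact: dotv_le_norm2.
Qed.

Lemma lsq_angle : A *m x != 0 -> let theta := angle_colspace A b in
  [/\ 0 <= theta < pi / 2, cos theta = norm2 (A *m x) / norm2 b &
      tan theta = norm2 r / norm2 (A *m x)].
Proof.
move=> Ax0 theta; rewrite /theta lsq_angle_colspace//.
have nAx : 0 < norm2 (A *m x) by rewrite norm2_gt0.
have nb : 0 < norm2 b.
  rewrite lt0r norm2_ge0 andbT -sqrf_eq0 norm2_sqr_lsq gt_eqF//.
  by rewrite ltr_pwDl ?sqr_ge0// exprn_gt0.
set c := norm2 (A *m x) / norm2 b.
have c0 : 0 < c by rewrite divr_gt0.
have c1 : c <= 1.
  rewrite ler_pdivrMr// mul1r -ler_sqr ?nnegrE ?norm2_ge0// norm2_sqr_lsq.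
  by rewrite lerDl sqr_ge0.
have cI : -1 <= c <= 1 by rewrite c1 andbT (le_trans _ (ltW c0))// oppr_le0.
have cosc : cos (acos c) = c by rewrite acosK// in_itv.
split=> //.
  rewrite acos_ge0//= -ltr_cos ?in_itv/= ?acos_ge0 ?acos_lepi//.
    by rewrite cos_pihalf cosc.
  by rewrite divr_ge0 ?pi_ge0//= ler_pdivrMr// ler_peMr ?pi_ge0// ler1n.
rewrite /tan cosc sin_acos//.
(* By Pythagoras the sine is |r| / |b|. *)
have -> : 1 - c ^+ 2 = (norm2 r / norm2 b) ^+ 2.
  rewrite /c !expr_div_n norm2_sqr_lsq; field.
  by rewrite gt_eqF// ltr_pwDl ?sqr_ge0// exprn_gt0.
rewrite sqrtr_sqr ger0_norm ?divr_ge0 ?norm2_ge0// /c.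
by field; rewrite !gt_eqF.
Qed.

End Angle.

Theorem theorem4p1 (R : realType) (m n : nat) (n_gt0 : (0 < n)%N)
    (A : 'M[R]_(m, n)) (b : 'cV[R]_m) (fullA : \rank A = n) :
  let x := lsq A b in
  let r := b - A *m x in
  let smin := sigma_min A in
  (* the Frechet derivatives D_A x and D_b x exist at (A, b) *)
  [/\ differentiable (fun A' : 'M[R]_(m, n) => lsq A' b) A,
      differentiable (lsq A) b,
  (* arbitrary positive scale factors *)
      forall cA cB cX : R, 0 < cA -> 0 < cB -> 0 < cX ->
        (* the maxima exist *)
        [/\ has_max (condA_ratios cA cX A b),
            has_max (condb_ratios cB cX A b) &
            has_max (sigma12_values A b)] /\
        [/\ condb cB cX A b = cB / (cX * smin),
            condA cA cX A b = cA / cX * max_of (sigma12_values A b),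
            cA / (cX * smin) * Num.sqrt ((norm2 r / smin) ^+ 2 + norm2 x ^+ 2)
              <= condA cA cX A b,
            condA cA cX A b
              <= cA / (cX * smin) * (norm2 r / smin + norm2 x) &
            cA / (cX * smin) * (norm2 r / smin + norm2 x)
              <= Num.sqrt 2 * condA cA cX A b] &
  (* the scale factors |A|_2, |b|_2 and |x|_2 *)
      x != 0 ->
        let cA := spnorm A in
        let cB := norm2 b in
        let cX := norm2 x in
        let kappa2 := spnorm A / smin in
        let v := norm2 (A *m x) / (norm2 x * smin) in
        let theta := angle_colspace A b in
        [/\ 0 <= theta < pi / 2 /\ tan theta = norm2 r / norm2 (A *m x),
            condb cB cX A b = v * (cos theta)^-1,
            kappa2 * Num.sqrt ((v * tan theta) ^+ 2 + 1) <= condA cA cX A b &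
            condA cA cX A b <= kappa2 * (v * tan theta + 1)]].
Proof.
move=> x r smin.
have s0 : 0 < smin by exact: sigma_min_gt0.
have [db _] := diff_lsq_b A b.
split=> //; first exact: (diff_lsq_A n_gt0 b fullA).
  move=> cA cB cX cA0 cB0 cX0.
  have [hA EA] := condA_max n_gt0 b fullA cA0 cX0.
  have [hB EB] := condb_max n_gt0 b fullA cB0 cX0.
  have [hS _] := sigma12_max n_gt0 b fullA.
  have /andP[lo up] := condA_bounds n_gt0 b fullA cA0 cX0.
  split; split=> //; apply: le_trans (ler_wpM2l (sqrtr_ge0 2) lo).
  have c_ge0 : 0 <= cA / (cX * smin) by rewrite divr_ge0 ?mulr_ge0 ?ltW.
  rewrite mulrCA ler_wpM2l//.
  (* With the lower bound in place of [condA], what remains is p + q <= sqrt 2 * sqrt (p^2 + q^2),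
     that is (p - q)^2 >= 0. *)
  set p := norm2 _ / _; set q := norm2 _.
  rewrite -sqrtrM// (le_trans (ler_norm _))// -sqrtr_sqr ler_wsqrtr//.
  have := sqr_ge0 (p - q); lra.
move=> x0 cA cB cX kappa2 v theta.
have cX0 : 0 < cX by rewrite norm2_gt0.
(* A is injective, so x != 0 gives A x != 0, which keeps theta below pi / 2. *)
have nAx : 0 < norm2 (A *m x).
  rewrite (lt_le_trans _ (sigma_min_le _ _ _)) ?mulr_gt0//.
  by rewrite -fullA rank_leq_row.
have Ax0 : A *m x != 0 by rewrite -norm2_gt0.
have cA0 : 0 < cA.
  by apply: spnorm_gt0; apply: contraNneq Ax0 => ->; rewrite mul0mx.
have [th cos_th tan_th] := lsq_angle n_gt0 fullA Ax0.
have cB0 : 0 < cB.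
  rewrite norm2_gt0; apply: contraNneq x0 => b0.
  by rewrite /x b0 /lsq mulmx0.
have /andP[lo up] := condA_bounds n_gt0 b fullA cA0 cX0.
have [_ EB] := condb_max n_gt0 b fullA cB0 cX0.
have vtan : v * tan theta = norm2 r / smin / cX.
  rewrite /v /theta tan_th -/x -/r -/cX; field.
  by rewrite !gt_eqF.
split; first by [].
- rewrite EB /theta cos_th /v -/x -/smin -/cX -/cB; field.
  by rewrite !gt_eqF.
- apply: le_trans lo; rewrite vtan -/x -/r -/smin -/cX.
  rewrite (_ : (_ / cX) ^+ 2 + 1 =
    ((norm2 r / smin) ^+ 2 + cX ^+ 2) / cX ^+ 2); last first.
    by field; rewrite !gt_eqF.
  rewrite sqrtrM ?addr_ge0 ?sqr_ge0// sqrtrV ?sqr_ge0// sqrtr_sqr gtr0_norm//.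
  rewrite le_eqVlt /kappa2 -/cA; apply/orP; left; apply/eqP; field.
  by rewrite !gt_eqF.
- apply: le_trans up _; rewrite vtan -/x -/r -/smin -/cX.
  rewrite le_eqVlt /kappa2 -/cA; apply/orP; left; apply/eqP; field.
  by rewrite !gt_eqF.
Qed.
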